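(* Let $G$ be a connected bipartite graph with color classes $X$ and $Y$ and with no universal vertex. Let $\mathcal{B}(G)$ be the set of inclusion-wise maximal bicliques of $G$, partially ordered by $B\preceq B' \iff X(B)\subseteq X(B')$, and let $\mathbf{H}(G)$ be the transitive reduction of $(\mathcal{B}(G),\preceq)$. Then (the underlying undirected graph of) $\mathbf{H}(G)$ is a tree if and only if $G$ is a bipartite distance hereditary (BDH) graph.
   Context: A biclique of a bipartite graph $G$ with color classes $X,Y$ is a vertex set $B$ inducing a complete bipartite subgraph; its shores are $X(B)=B\cap X$ and $Y(B)=B\cap Y$. $\mathcal{B}(G)$ denotes the inclusion-wise maximal bicliques. Note $X(B)\subseteq X(B')\iff Y(B)\supseteq Y(B')$ for maximal bicliques. The transitive reduction of a poset is the directed graph on its elements with an arc from $x$ to $y$ iff $y$ covers $x$. A universal vertex of a bipartite graph is a vertex adjacent to all vertices of the opposite color class. A graph $G$ is distance hereditary if for every connected induced subgraph $H$ of $G$ and all $u,v\in V(H)$, $d_H(u,v)=d_G(u,v)$; a BDH graph is a bipartite distance hereditary graph. (Equivalently, a bipartite graph is BDH iff it has no induced chordless cycle of length $\ge 6$ and no induced domino, where a domino is $C_6$ plus a chord joining two antipodal vertices.) *)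

(* Defs.v *)
From mathcomp Require Import all_boot.
Set Implicit Arguments. Unset Strict Implicit. Unset Printing Implicit Defensive.

(* A graph on a finite vertex type T is given by a symmetric, irreflexive
   adjacency relation e.  Bipartite graphs come with the colour class X;
   the other colour class is Y = ~: X. *)

Section Graphs.
Variables (T : finType) (e : rel T).

Definition conn_in (S : {set T}) (u v : T) : Prop :=
  u \in S /\ exists p : seq T, [/\ path e u p, last u p = v & all (mem S) p].

Definition connected_on (S : {set T}) : Prop :=
  S != set0 /\ forall u v, u \in S -> v \in S -> conn_in S u v.

Definition ball (S : {set T}) (u : T) (n : nat) : {set T} :=
  iter n (fun A => A :|: [set y in S | [exists x in A, e x y]]) ([set u] :&: S).

(* distance d_{G[S]}(u,v): least n with v in ball S u n; #|T| if unreachable *)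
Definition dist_in (S : {set T}) (u v : T) : nat :=
  find (fun n => v \in ball S u n) (iota 0 #|T|).

Definition distance_hereditary : Prop :=
  forall S : {set T}, connected_on S ->
    forall u v, u \in S -> v \in S -> dist_in S u v = dist_in setT u v.

Variable X : {set T}.

Definition bipartite_with : Prop :=
  forall x y, e x y -> (x \in X) != (y \in X).

Definition BDH : Prop := bipartite_with /\ distance_hereditary.

Definition universal (v : T) : bool :=
  [forall w, ((v \in X) != (w \in X)) ==> e v w].

Definition biclique (B : {set T}) : bool :=
  [&& B :&: X != set0, B :\: X != set0 &
      [forall x in B :&: X, forall y in B :\: X, e x y]].

Definition max_biclique (B : {set T}) : bool :=
  biclique B && [forall B' : {set T}, (biclique B' && (B \subset B')) ==> (B' == B)].

Definition maxbicliques : {set {set T}} := [set B | max_biclique B].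

Definition bprec (B B' : {set T}) : bool := (B :&: X) \subset (B' :&: X).

Definition bcovers (B B' : {set T}) : bool :=
  [&& B \in maxbicliques, B' \in maxbicliques, B != B', bprec B B' &
      [forall C in maxbicliques,
         ((C != B) && (C != B') && bprec B C && bprec C B') ==> false]].

(* underlying undirected graph of the transitive reduction H(G) *)
Definition Hrel : rel {set T} := fun B B' => bcovers B B' || bcovers B' B.

End Graphs.

Definition tree_on (U : finType) (r : rel U) (V : {set U}) : Prop :=
  connected_on r V /\
  forall c : seq U, all (mem V) c -> uniq c -> 2 < size c -> ~~ cycle r c.

(* Main.v *)
Require Import Defs.
From mathcomp Require Import all_boot zify.
Set Implicit Arguments. Unset Strict Implicit. Unset Printing Implicit Defensive.

(* Call an induced path of length at least 3 roofed when its ends have a common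
   neighbour.  A graph is distance hereditary iff it has no roofed induced path:
   by induction on d(u, v), extend an initial piece of an induced u-v path by the
   neighbour of v that precedes it on a geodesic.

   On the other side, H is acyclic iff every cover C < D is a bridge of H, and
   this holds iff no path of G leads from X(C) to Y(D) once the edges between
   X(C) and Y(D) are deleted.  Given a roofed path p_0 ... p_k with roof w and p_0
   in X, take a cover C < D between the biclique generated by p_0 and a biclique
   containing p_0, p_k, w, at which p_1 leaves: then p_0 ... p_k w is a forbidden
   path.  Conversely, a shortest forbidden path of length at least 5 is a roofed
   path together with its roof, and one of length 3 closes up to a 4-cycle whose
   maximal biclique would lie strictly between C and D, because without dominoes
   maximal bicliques that meet in both shores are comparable. *)

(** * Walks indexed by natural numbers, and induced paths *)

Section Walks.
Variables (T : finType) (r : rel T).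

Definition walk (p : nat -> T) (n : nat) : Prop :=
  forall i, i < n -> r (p i) (p i.+1).

Definition ipath (p : nat -> T) (n : nat) : Prop :=
  walk p n /\
  forall i j, i < j -> j <= n -> p i <> p j /\ (r (p i) (p j) -> j = i.+1).

Lemma walk_connect p n i j : walk p n -> i <= j -> j <= n -> connect r (p i) (p j).
Proof.
move=> wp; elim: j => [|j IH]; first by rewrite leqn0 => /eqP->.
rewrite leq_eqVlt => /predU1P[-> //|ij] jn.
by apply: connect_trans (IH ij (ltnW jn)) (connect1 (wp _ _)).
Qed.

Lemma path_walk x s : path r x s -> walk (nth x (x :: s)) (size s).
Proof. by move=> /(pathP x) h i /h. Qed.

Lemma connect_walk x y :
  connect r x y -> exists p n, [/\ walk p n, p 0 = x & p n = y].
Proof.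
case/connectP => s hs ->; exists (nth x (x :: s)), (size s).
by split; [exact: path_walk | | rewrite -[size s]/((size (x :: s)).-1) nth_last].
Qed.

(** A repeated vertex or a chord at indices [i < j] allows a shortcut with the same ends. *)
Lemma shortest_walk_ipath p n : walk p n ->
  (forall m q, m < n -> walk q m -> q 0 = p 0 -> q m = p n -> False) ->
  ipath p n.
Proof.
move=> wp minp; split=> // i j ij jn.
(* [q d] follows [p] up to [i] and then skips [d] indices: [d = j - i] exploits [p i = p j], and
   [d = j - i.+1] exploits a chord. *)
pose q d t := if t <= i then p t else p (t + d).
split=> [eqp | rp].
- apply: (minp (n - (j - i)) (q (j - i))); first by lia.
  + move=> t tn; rewrite /q; case: (ltngtP t i) => ti.
    * by apply: wp; lia.
    * by rewrite addSn; apply: wp; lia.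
    * have -> : t.+1 + (j - i) = j.+1 by lia.
      by rewrite ti eqp; apply: wp; lia.
  + by rewrite /q.
  + rewrite /q; case: leqP => h; last by congr p; lia.
    have -> : n - (j - i) = i by lia.
    by rewrite eqp; congr p; lia.
- apply/eqP; rewrite eqn_leq ij andbT leqNgt; apply/negP=> lt_ij.
  apply: (minp (n - (j - i.+1)) (q (j - i.+1))); first by lia.
  + move=> t tn; rewrite /q; case: (ltngtP t i) => ti.
    * by apply: wp; lia.
    * by rewrite addSn; apply: wp; lia.
    * have -> : t.+1 + (j - i.+1) = j by lia.
      by rewrite ti.
  + by rewrite /q.
  + by rewrite /q; case: leqP => h; [lia | congr p; lia].
Qed.

Lemma ipath_drop p n i : i <= n -> ipath p n -> ipath (fun t => p (i + t)) (n - i).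
Proof.
move=> le_in [wp ip]; split=> [t ti | a b ab bn].
  by rewrite addnS; apply: wp; lia.
have [|//|? h] := ip (i + a) (i + b); [by lia | by lia |].
by split=> // /h; lia.
Qed.

Lemma ipath_take p n i : i <= n -> ipath p n -> ipath p i.
Proof.
by move=> le_in [wp ip]; split=> [t ti | a b ab bn]; [apply: wp | apply: ip]; lia.
Qed.

End Walks.

(** * Cycles and bridges of a symmetric relation *)

Section Bridges.
Variables (U : finType) (r : rel U).
Hypothesis r_sym : symmetric r.

Definition del_edge (a b : U) : rel U :=
  [rel u v | [&& r u v, (u, v) != (a, b) & (u, v) != (b, a)]].

Lemma del_edge_sym a b : symmetric (del_edge a b).
Proof.
move=> u v; rewrite /del_edge /= r_sym !xpair_eqE; congr (_ && _).
by rewrite andbC [(v == a) && _]andbC [(v == b) && _]andbC.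
Qed.

Lemma del_edgeC a b : del_edge a b =2 del_edge b a.
Proof. by move=> u v; rewrite /del_edge /= [X in _ && X]andbC. Qed.

(** The other edges of a cycle through [a b] lead from [b] back to [a], so [a b] is not a bridge. *)
Lemma bridges_acyclic :
  (forall a b, r a b -> ~~ connect (del_edge a b) a b) ->
  forall c, uniq c -> 2 < size c -> ~~ cycle r c.
Proof.
move=> br [|a [|b [|d s]]] //= /and4P[].
rewrite !inE !negb_or => /and3P[ab ad as_] /andP[bd bs] ds us _.
apply/negP => /and3P[rab rbd pth].
apply/negP: (br _ _ rab); rewrite (sym_connect_sym (del_edge_sym a b)).
apply/negPn; apply: connect_trans (connect1 (y := d) _) _.
  by rewrite /del_edge /= rbd !xpair_eqE ![_ == a]eq_sym (negbTE ab) (negbTE ad) andbF.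
apply/connectP; exists (rcons s a); last by rewrite last_rcons.
(* From [d] on, the cycle avoids [b], hence never uses the deleted edge. *)
apply: (sub_in_path (P := predC1 b)) pth => [u v|].
  rewrite /del_edge !inE /= !xpair_eqE => /negbTE-> /negbTE-> ->.
  by rewrite andbF.
apply/allP => u; rewrite -rcons_cons mem_rcons !inE => /or3P[/eqP->|/eqP->|us'] //.
  by rewrite eq_sym.
by apply: contraNneq bs => <-.
Qed.


(** A detour from [a] to [b] closes up with the edge [a b] to a cycle. The set [V] matches
    [tree_on], which excludes cycles inside a vertex set. *)
Lemma acyclic_bridge (V : {set U}) a b :
  (forall u v, r u v -> u \in V) ->
  (forall c, all (mem V) c -> uniq c -> 2 < size c -> ~~ cycle r c) ->
  r a b -> a != b -> ~~ connect (del_edge a b) a b.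
Proof.
move=> rV acyc rab neq_ab; apply/negP => /connectP[s hs lasts].
case/shortenP: hs lasts => s' hs' us' _ lasts.
have hr : path r a s' by apply: sub_path hs' => u v /and3P[].
have cyc : cycle r (a :: s') by rewrite /= rcons_path hr -lasts r_sym.
(* A detour without edges gives [a = b], and one with a single edge is the deleted edge; all others
   give cycles of at least three vertices. *)
case: s' => [|z [|z' s2]] in hs' us' lasts hr cyc *.
- by rewrite lasts eqxx in neq_ab.
- by move: hs'; rewrite /del_edge /= -[z]lasts eqxx /= andbF.
- apply/negP: (cyc); apply: acyc => //; apply/allP => u us.
  by have := next_cycle cyc us; apply: rV.
Qed.

End Bridges.

(** * Distance heredity as the absence of roofed induced paths *)

Section DistanceHereditary.
Variables (T : finType) (e : rel T).
Hypothesis e_sym : symmetric e.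

(* The roof [w] may be adjacent to inner vertices of the path. *)
Definition no_roofed_ipath : Prop :=
  forall p k w, ipath e p k -> 2 < k -> e w (p 0) -> ~~ e w (p k).

Lemma in_ballS (S : {set T}) u n v :
  (v \in ball e S u n.+1) =
  (v \in ball e S u n) || (v \in S) && [exists x in ball e S u n, e x v].
Proof. by rewrite /ball /= !inE. Qed.

Lemma ball_leq (S : {set T}) u m n : m <= n -> {subset ball e S u m <= ball e S u n}.
Proof.
move=> /subnKC <-; elim: (n - m) => [|d IH] v vm; first by rewrite addn0.
by rewrite addnS in_ballS IH.
Qed.

Lemma ballS_edge (S : {set T}) u n x v :
  x \in ball e S u n -> e x v -> v \in S -> v \in ball e S u n.+1.
Proof.
by move=> xb xv vS; rewrite in_ballS vS; apply/orP; right; apply/existsP; exists x; rewrite xb.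
Qed.

Lemma ball_subset (S S' : {set T}) u n :
  S \subset S' -> {subset ball e S u n <= ball e S' u n}.
Proof.
move=> sSS'; elim: n => [|n IH] v.
  by rewrite !inE => /andP[-> /(subsetP sSS')].
rewrite in_ballS => /orP[/IH|/andP[/(subsetP sSS') vS' /exists_inP[x /IH xb xv]]].
  exact: ball_leq.
exact: ballS_edge xb xv vS'.
Qed.

Lemma walk_ball (S : {set T}) p n :
  walk e p n -> (forall i, i <= n -> p i \in S) -> p n \in ball e S (p 0) n.
Proof.
move=> wp pS; suff h i : i <= n -> p i \in ball e S (p 0) i by exact: h.
elim: i => [|i IH] i_n; first by rewrite !inE eqxx pS.
exact: ballS_edge (IH (ltnW i_n)) (wp _ _) (pS _ _).
Qed.

(** Induction on [l], for all induced paths at once: [x] precedes [p k] on a walk of length at most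
    [l.+1] from [p 0]. *)
Lemma ipath_leq_dist p k l :
  no_roofed_ipath -> ipath e p k -> p k \in ball e setT (p 0) l -> k <= l.
Proof.
move=> roof; elim: l p k => [|l IH] p k ip.
  rewrite !inE andbT => /eqP eq_p; rewrite leqn0; apply/negPn/negP => k0.
  by case: (ip.2 0 k) => //; [rewrite lt0n | case].
rewrite in_ballS inE => /orP[/(IH _ _ ip) /leqW //|/exists_inP[x xb xk]].
(* If [x = p j] with [j < k], inducedness forces [k = j.+1], while [j <= l] by induction. *)
have [/existsP[j /eqP pj]|/existsPn xp] := boolP [exists j : 'I_k.+1, p j == x].
  have lej : j <= l by apply: (IH p j); [apply: ipath_take ip; rewrite -ltnS | rewrite pj].
  have := ltn_ord j; rewrite ltnS leq_eqVlt => /predU1P[|jk]; first by lia.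
  by have [_ ->] := ip.2 _ _ jk (leqnn k); rewrite ?pj // ltnS.
(* Otherwise take the first neighbour [p i] of [x]: the path [p 0 ... p i x] is induced, so
   [i.+1 <= l]. *)
have exi : exists i, (i <= k) && e x (p i) by exists k; rewrite leqnn.
case: (ex_minnP exi) => i /andP[ik xi] mini.
pose q t := if t <= i then p t else x.
have iq : ipath e q i.+1.
  split=> [t ti | a b ab bi]; rewrite /q.
    have -> /= : t <= i by lia.
    have [h|h] := ltnP t i; first by apply: (proj1 ip); lia.
    by have -> : t = i by [lia]; rewrite e_sym.
  have -> /= : a <= i by lia.
  have [h|h] := leqP b i; first by apply: (proj2 ip); lia.
  split=> [pa|]; first by have := xp (inord a); rewrite inordK ?pa ?eqxx //; lia.
  by rewrite e_sym => xa; have := mini a; rewrite xa; lia.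
have : i.+1 <= l by apply: (IH _ _ iq); rewrite /q ltnn.
(* If [k - i > 2], the piece from [p i] to [p k] is roofed by [x]. *)
suff : k - i <= 2 by lia.
rewrite leqNgt; apply/negP => ki.
have := roof _ _ x (ipath_drop ik ip) ki; rewrite addn0 subnKC // xk.
by move/(_ xi).
Qed.

Lemma no_roofed_ipath_DH : no_roofed_ipath -> distance_hereditary e.
Proof.
move=> roof S [_ connS] u v uS vS; apply/eqP; rewrite eqn_leq; apply/andP; split; last first.
  by apply: sub_find => n; apply: ball_subset; exact: subsetT.
rewrite /dist_in; set F := find _ _; set l := find _ _.
have := find_size (fun n => v \in ball e setT u n) (iota 0 #|T|).
(* [l = #|T|] is the default value of [dist_in], which bounds every distance. *)
rewrite -/l size_iota leq_eqVlt => /predU1P[->|lT].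
  by rewrite /F -[X in _ <= X](size_iota 0) find_size.
have vl : v \in ball e setT u l.
  have /(nth_find 0) : has (fun n => v \in ball e setT u n) (iota 0 #|T|).
    by rewrite has_find size_iota.
  by rewrite nth_iota.
rewrite leqNgt; apply/negP => lF.
have vNl : v \notin ball e S u l.
  by have /(before_find 0) := lF; rewrite nth_iota // => ->.
pose rS := [rel x y | [&& e x y, x \in S & y \in S]].
(* Strong induction lets the walk be taken shortest inside [S], hence induced in the whole graph;
   its length is then at most [l], against [vNl]. *)
have nowalk n : forall p, walk rS p n -> p 0 = u -> p n = v -> False.
  elim/ltn_ind: n => n IH p wp p0 pn.
  have ipS : ipath rS p n.
    apply: shortest_walk_ipath wp _ => m q mn wq q0 qm.
    by apply: (IH m mn q wq); rewrite ?q0 ?qm.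
  have pS i : i <= n -> p i \in S.
    case: i => [|i] i_n; first by rewrite p0.
    by case/and3P: (wp _ i_n).
  have ip : ipath e p n.
    split=> [i /wp /and3P[] //|i j ij jn]; have [? h] := ipS.2 _ _ ij jn.
    by split=> // eij; apply: h; rewrite /= eij !pS //; lia.
  have nl : n <= l by apply: (ipath_leq_dist roof ip); rewrite p0 pn.
  case/negP: vNl; apply: (ball_leq nl); rewrite -p0 -pn.
  exact: walk_ball ip.1 pS.
have [_ [s [hs lasts sS]]] := connS _ _ uS vS.
apply: (nowalk (size s) (nth u (u :: s))) => //.
  apply: path_walk; apply: (sub_in_path (P := mem S)) hs => [x y xS yS xy|/=].
    by apply/and3P.
  by apply/andP.
by rewrite -[size s]/((size (u :: s)).-1) nth_last.
Qed.

Lemma connect_conn_in (S : {set T}) u v : u \in S ->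
  connect [rel x y | [&& e x y, x \in S & y \in S]] u v -> conn_in e S u v.
Proof.
move=> uS /connectP[s hs ->]; split=> //; exists s; split=> //.
  by apply: sub_path hs => x y /and3P[].
elim: s u uS hs => //= x s IH u uS /andP[/and3P[_ _ xS] hs].
by apply/andP; split; [|exact: IH hs].
Qed.

(** The vertices of a roofed path span a connected subgraph in which the ends are at distance
    [k > 2], whereas the roof brings them within distance 2. *)
Lemma DH_no_roofed_ipath : distance_hereditary e -> no_roofed_ipath.
Proof.
move=> dh p k w ip k2 w0; apply/negP => wk.
pose S := [set p (i : 'I_k.+1) | i in predT].
have inS i : i <= k -> p i \in S.
  by move=> ik; apply/imsetP; exists (inord i); rewrite ?inordK.
pose rS := [rel x y | [&& e x y, x \in S & y \in S]].
have wS : walk rS p k by move=> i ik; rewrite /= ip.1 // !inS //; lia.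
have rS_sym : symmetric rS by move=> x y; rewrite /rS /= e_sym [X in _ && X]andbC.
have cS : connected_on e S.
  split=> [|u v uS vS]; first by apply/set0Pn; exists (p 0); apply: inS.
  apply: connect_conn_in => //.
  have h x : x \in S -> connect rS (p 0) x.
    by case/imsetP=> i _ ->; apply: (walk_connect wS) => //; rewrite -ltnS.
  by apply: connect_trans (h v vS); rewrite (sym_connect_sym rS_sym) h.
(* [dist_in] only tries radii below [#|T|], so this ensures that radius 2 is tried and that a value
   at most 2 is not the default. *)
have T3 : 2 < #|T|.
  have : uniq [seq p (i : 'I_k.+1) | i <- enum 'I_k.+1].
    rewrite map_inj_uniq ?enum_uniq // => i j eqp; apply/val_inj => /=.
    have [jk ik] := (ltn_ord j, ltn_ord i).
    case: (ltngtP i j) => // lt; first by case: (proj1 (ip.2 i j lt jk) eqp).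
    by case: (proj1 (ip.2 j i lt ik) (esym eqp)).
  move/card_uniqP; rewrite size_map size_enum_ord => cardS.
  have := max_card (mem [seq p (i : 'I_k.+1) | i <- enum 'I_k.+1]).
  by rewrite cardS; lia.
have := dh S cS _ _ (inS 0 isT) (inS k (leqnn k)).
set d := dist_in _ setT _ _ => eq_d.
have d2 : d <= 2.
  rewrite leqNgt; apply/negP => d2; have /(before_find 0) := d2.
  rewrite nth_iota // add0n => /negP; apply.
  apply: ballS_edge wk _; last by rewrite inE.
  by apply: (@ballS_edge _ _ 0 (p 0)); rewrite ?inE ?eqxx // e_sym.
(* Inside [S], a step raises the index along the path by at most one. *)
have ball_S n v : v \in ball e S (p 0) n -> exists2 i, i <= n /\ i <= k & v = p i.
  elim: n v => [|n IH] v; first by rewrite !inE => /andP[/eqP-> _]; exists 0.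
  rewrite in_ballS => /orP[/IH[i [i1 i2] ->]|/andP[vS]].
    by exists i => //; split=> //; lia.
  case/exists_inP=> x /IH[i [i_n ik] ->].
  case/imsetP: vS => j _ -> eij; exists j => //; split; last by rewrite -ltnS.
  rewrite leqNgt; apply/negP=> ij; have [] := ip.2 i j; first by lia.
    by rewrite -ltnS.
  by move=> _ /(_ eij); lia.
have : p k \in ball e S (p 0) d.
  rewrite -eq_d /dist_in.
  have dS : find (fun n => p k \in ball e S (p 0) n) (iota 0 #|T|) < #|T|.
    by apply: leq_ltn_trans T3; move: d2; rewrite -eq_d.
  have /(nth_find 0) : has (fun n => p k \in ball e S (p 0) n) (iota 0 #|T|).
    by rewrite has_find size_iota.
  by rewrite nth_iota.
case/ball_S=> i [i_d _] eqp; have [] := ip.2 i k; [by lia|by []|].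
by rewrite eqp.
Qed.

End DistanceHereditary.

(** * Maximal bicliques: their order, covers, and the bicliques generated by vertices *)

Section Bicliques.
Variables (T : finType) (e : rel T) (X : {set T}).
Hypotheses (e_sym : symmetric e) (bip : bipartite_with e X).

Local Notation mb := (maxbicliques e X).
Local Notation "A <=b B" := (bprec X A B) (at level 70).
Local Notation cover := (bcovers e X).
Local Notation H := (Hrel e X).

Lemma bipX x y : e x y -> (y \in X) = (x \notin X).
Proof. by move=> /bip; case: (x \in X); case: (y \in X). Qed.

Lemma bicliqueI (B : {set T}) x0 y0 :
  x0 \in B -> x0 \in X -> y0 \in B -> y0 \notin X ->
  (forall x y, x \in B -> x \in X -> y \in B -> y \notin X -> e x y) ->
  biclique e X B.
Proof.
move=> x0B x0X y0B y0X h; apply/and3P; split.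
- by apply/set0Pn; exists x0; rewrite inE x0B.
- by apply/set0Pn; exists y0; rewrite inE y0B y0X.
- apply/forall_inP => x; rewrite inE => /andP[xB xX].
  by apply/forall_inP => y; rewrite inE => /andP[yX yB]; exact: h.
Qed.

Lemma biclique_edge B x y :
  biclique e X B -> x \in B -> x \in X -> y \in B -> y \notin X -> e x y.
Proof.
case/and3P=> _ _ /forall_inP h xB xX yB yX.
have /h /forall_inP : x \in B :&: X by rewrite inE xB.
by apply; rewrite inE yX.
Qed.

Lemma mb_biclique B : B \in mb -> biclique e X B.
Proof. by rewrite inE => /andP[]. Qed.

Lemma mb_edge B x y : B \in mb ->
  x \in B -> x \in X -> y \in B -> y \notin X -> e x y.
Proof. by move/mb_biclique; exact: biclique_edge. Qed.

Lemma mb_hasX B : B \in mb -> exists2 x, x \in B & x \in X.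
Proof.
by move/mb_biclique => /and3P[/set0Pn[x]]; rewrite inE => /andP[]; exists x.
Qed.

Lemma mb_hasY B : B \in mb -> exists2 y, y \in B & y \notin X.
Proof.
by move/mb_biclique => /and3P[_ /set0Pn[y]]; rewrite inE => /andP[]; exists y.
Qed.

(** [v |: B] is again a biclique, so maximality applies. *)
Lemma mb_memX B v : B \in mb -> v \in X ->
  (forall y, y \in B -> y \notin X -> e v y) -> v \in B.
Proof.
move=> mB vX h; have [y0 y0B y0X] := mb_hasY mB.
have bvB : biclique e X (v |: B).
  apply: (@bicliqueI _ v y0) => [|//||//|x y]; rewrite ?setU11 // ?inE ?y0B ?orbT //.
  case/predU1P=> [-> _|xB xX]; case/predU1P=> [->|yB yX]; rewrite ?vX //.
    exact: h.
  exact: mb_edge mB _ _ _ _.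
move: mB; rewrite inE => /andP[_ /forallP /(_ (v |: B))].
by rewrite bvB subsetUr => /eqP <-; rewrite setU11.
Qed.

Lemma mb_memY B v : B \in mb -> v \notin X ->
  (forall x, x \in B -> x \in X -> e x v) -> v \in B.
Proof.
move=> mB vX h; have [x0 x0B x0X] := mb_hasX mB.
have bvB : biclique e X (v |: B).
  apply: (@bicliqueI _ x0 v) => [|//||//|x y]; rewrite ?setU11 // ?inE ?x0B ?orbT //.
  case/predU1P=> [->|xB xX]; first by rewrite (negbTE vX).
  case/predU1P=> [-> _|yB yX]; first exact: h.
  exact: mb_edge mB _ _ _ _.
move: mB; rewrite inE => /andP[_ /forallP /(_ (v |: B))].
by rewrite bvB subsetUr => /eqP <-; rewrite setU11.
Qed.

Lemma mb_extend B : biclique e X B -> exists2 M, M \in mb & B \subset M.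
Proof.
case/maxset_exists=> M /maxsetP[bM maxM] sBM; exists M => //.
rewrite inE /max_biclique bM; apply/forallP => B'.
by apply/implyP => /andP[bB' sMB']; apply/eqP; apply: maxM.
Qed.

Lemma bprecX (A B : {set T}) x : A <=b B -> x \in X -> x \in A -> x \in B.
Proof.
move=> AB xX xA; have /(subsetP AB) : x \in A :&: X by rewrite inE xA.
by rewrite inE => /andP[].
Qed.

(** The order reverses on the other shore: [y] is adjacent to the [X]-shore of [B], which contains
    that of [A]. *)
Lemma bprecY (A B : {set T}) y : A \in mb -> B \in mb -> A <=b B ->
  y \notin X -> y \in B -> y \in A.
Proof.
move=> mA mB AB yX yB; apply: mb_memY => // x xA xX.
exact: mb_edge mB (bprecX AB xX xA) xX yB yX.
Qed.

Lemma bprecI (A B : {set T}) : (forall x, x \in X -> x \in A -> x \in B) -> A <=b B.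
Proof.
by move=> h; apply/subsetP => x; rewrite !inE => /andP[xA xX]; rewrite h.
Qed.

Lemma bprecIY (A B : {set T}) : A \in mb -> B \in mb ->
  (forall y, y \notin X -> y \in B -> y \in A) -> A <=b B.
Proof.
move=> mA mB h; apply: bprecI => x xX xA; apply: mb_memX => // y yB yX.
exact: mb_edge mA xA xX (h _ yX yB) yX.
Qed.

Lemma bprec_refl A : A <=b A. Proof. exact: subxx. Qed.

Lemma bprec_trans B A C : A <=b B -> B <=b C -> A <=b C.
Proof. exact: subset_trans. Qed.

Lemma bprec_anti (A B : {set T}) : A \in mb -> B \in mb -> A <=b B -> B <=b A -> A = B.
Proof.
move=> mA mB AB BA; apply/setP => v; have [vX|vX] := boolP (v \in X).
  by apply/idP/idP; [apply: (bprecX AB) | apply: (bprecX BA)].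
by apply/idP/idP; [apply: (bprecY mB mA BA) | apply: (bprecY mA mB AB)].
Qed.

Lemma coverP (A B : {set T}) : reflect
  [/\ A \in mb, B \in mb, A != B, A <=b B &
      forall C, C \in mb -> A <=b C -> C <=b B -> C = A \/ C = B] (cover A B).
Proof.
apply: (iffP and5P) => -[mA mB nAB AB h]; split=> //.
  move=> C mC leAC CB; have := forall_inP h C mC; rewrite leAC CB !andbT implybF.
  by rewrite negb_and !negbK => /orP[] /eqP->; [left | right].
apply/forall_inP => C mC; rewrite implybF; apply/negP => /andP[/andP[/andP[nA nB] leAC] CB].
by case: (h C mC leAC CB) nA nB => ->; rewrite eqxx.
Qed.

(** Refining [A <=b B] to a chain of covers, by induction on the difference of the [X]-shore sizes.
    Only covers inside the interval matter, which later shows that a given cover is avoided. *)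
Lemma chain_ind (P : {set T} -> {set T} -> Prop) (A B : {set T}) :
  (forall C, P C C) -> (forall D C F, P C D -> P D F -> P C F) ->
  (forall C D, cover C D -> A <=b C -> D <=b B -> P C D) ->
  A \in mb -> B \in mb -> A <=b B -> P A B.
Proof.
move=> Prefl Ptrans; have [n] := ubnP (#|B :&: X| - #|A :&: X|).
elim: n A B => // n IH A B size_n Pcov mA mB AB.
have [->//|neqAB] := eqVneq A B.
have lt_card (C D : {set T}) : C \in mb -> D \in mb -> C != D -> C <=b D ->
    #|C :&: X| < #|D :&: X|.
  move=> mC mD nCD CD; apply: proper_card; rewrite properE; apply/andP; split=> //.
  by apply: contra nCD => DC; apply/eqP; exact: bprec_anti.
have [/exists_inP[C mC /and4P[nCA nCB leAC CB]]|none] :=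
    boolP [exists C in mb, [&& C != A, C != B, A <=b C & C <=b B]].
  have ltAC : #|A :&: X| < #|C :&: X| by apply: lt_card; rewrite // eq_sym.
  have ltCB : #|C :&: X| < #|B :&: X| by apply: lt_card.
  have [sAC sCB] : #|C :&: X| - #|A :&: X| < n /\ #|B :&: X| - #|C :&: X| < n.
    by move: size_n ltAC ltCB; clear; lia.
  apply: (Ptrans C); apply: IH => // D F DF.
    by move=> AD FC; apply: Pcov => //; exact: bprec_trans CB.
  by move=> CD FB; apply: Pcov => //; exact: bprec_trans CD.
apply: Pcov; rewrite ?bprec_refl //; apply/coverP; split=> // C mC leAC CB.
have := exists_inPn none C mC; rewrite leAC CB !andbT negb_and !negbK.
by case/orP=> /eqP->; [left | right].
Qed.

Lemma cover_mb A B : cover A B -> A \in mb /\ B \in mb.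
Proof. by case/coverP. Qed.

Lemma cover_bprec A B : cover A B -> A <=b B.
Proof. by case/coverP. Qed.

Lemma cover_nbprec A B : cover A B -> ~~ (B <=b A).
Proof.
case/coverP=> mA mB nAB AB _; apply: contra nAB => BA.
by apply/eqP; exact: bprec_anti.
Qed.

Lemma H_sym : symmetric H.
Proof. by move=> A B; rewrite /Hrel orbC. Qed.

Lemma H_mb A B : H A B -> A \in mb.
Proof. by case/orP=> /cover_mb[]. Qed.

Lemma H_neq A B : H A B -> A != B.
Proof. by case/orP=> /coverP[] // _ _; rewrite eq_sym. Qed.

(** If no cover of the chain lost [y], then [y] would survive up to [B]. *)
Lemma cover_leaveY (A B : {set T}) y : A \in mb -> B \in mb -> A <=b B ->
  y \in A -> y \notin B ->
  exists C D, [/\ cover C D, A <=b C, D <=b B, y \in C & y \notin D].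
Proof.
move=> mA mB AB yA yB.
have [/existsP[C /existsP[D /and5P[*]]]|none] := boolP [exists C, exists D,
    [&& cover C D, A <=b C, D <=b B, y \in C & y \notin D]].
  by exists C, D.
suff : y \in B by rewrite (negbTE yB).
move: yA; apply: (chain_ind (P := fun C D => y \in C -> y \in D)) mA mB AB => //.
  by move=> D C E CD DE /CD.
move=> C D CD leAC DB yC; move/existsPn/(_ C)/existsPn/(_ D): none.
by rewrite CD leAC DB yC /= negbK.
Qed.

Lemma cover_enterX (A B : {set T}) x : A \in mb -> B \in mb -> A <=b B ->
  x \notin A -> x \in B ->
  exists C D, [/\ cover C D, A <=b C, D <=b B, x \notin C & x \in D].
Proof.
move=> mA mB AB xA xB.
have [/existsP[C /existsP[D /and5P[*]]]|none] := boolP [exists C, exists D,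
    [&& cover C D, A <=b C, D <=b B, x \notin C & x \in D]].
  by exists C, D.
suff : x \notin B by rewrite xB.
move: xA; apply: (chain_ind (P := fun C D => x \notin C -> x \notin D)) mA mB AB => //.
  by move=> D C E CD DE /CD.
move=> C D CD leAC DB xC; move/existsPn/(_ C)/existsPn/(_ D): none.
by rewrite CD leAC DB xC.
Qed.

(* The maximal biclique generated by [v]: the opposite shore is [N(v)] and, when
   [N(v)] is nonempty, [N(v) \subset N(z)] already forces [z] on the side of [v]. *)
Definition star (v : T) : {set T} :=
  [set z | e v z] :|: [set z | [forall u, e v u ==> e z u]].

Lemma in_star v z : reflect (e v z \/ forall u, e v u -> e z u) (z \in star v).
Proof.
rewrite !inE; apply: (iffP orP) => -[]; [by left | | by left |].
  by move/forallP=> h; right=> u; apply/implyP.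
by move=> h; right; apply/forallP => u; apply/implyP/h.
Qed.

Lemma star_refl v : v \in star v.
Proof. by apply/in_star; right. Qed.

Lemma star_opp v z : (exists u, e v u) ->
  z \in star v -> (z \in X) = (v \notin X) -> e v z.
Proof.
case=> u vu /in_star[//|h] zX.
have := bipX vu; rewrite (bipX (h u vu)) zX.
by case: (v \in X).
Qed.

Lemma star_same v z u : z \in star v -> (z \in X) = (v \in X) -> e v u -> e z u.
Proof.
by move=> /in_star[vz|h] zX; [have := bipX vz; rewrite zX; case: (v \in X) | exact: h].
Qed.

(** In a maximal biclique [M] containing [star v], the shore opposite [v] lies in the neighbourhood
    of [v], and the other shore is adjacent to that whole neighbourhood; hence [M] is [star v]. *)
Lemma star_mb v : (exists u, e v u) -> star v \in mb.
Proof.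
move=> nbr; have [u vu] := nbr.
have us : u \in star v by apply/in_star; left.
have vs := star_refl v; have uX := bipX vu.
have bs : biclique e X (star v).
  case: (boolP (v \in X)) uX => vX uX.
    apply: (bicliqueI vs vX us); rewrite ?uX // => x y xs xX ys yX.
    apply: (star_same xs); first by rewrite xX vX.
    by apply: star_opp => //; rewrite vX (negbTE yX).
  apply: (bicliqueI us _ vs vX); rewrite ?uX // => x y xs xX ys yX.
  rewrite e_sym; apply: (star_same ys); first by rewrite (negbTE vX) (negbTE yX).
  by apply: star_opp => //; rewrite xX vX.
have [M mM sM] := mb_extend bs; suff -> : star v = M by [].
apply/eqP; rewrite eqEsubset sM; apply/subsetP => z zM; apply/in_star.
have vM := subsetP sM _ vs.
have adjM a b : a \in M -> b \in M -> (a \in X) = (b \notin X) -> e a b.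
  move=> aM bM; case: (boolP (b \in X)) => bX aX; last exact: mb_edge mM _ _ _ _.
  by rewrite e_sym; apply: mb_edge mM _ _ _ _; rewrite ?aX.
have [eqX|neX] := eqVneq (z \in X) (v \in X); last first.
  by left; apply: adjM => //; move: neX; case: (z \in X); case: (v \in X).
right=> w vw; apply: adjM => //; last by rewrite (bipX vw) negbK.
by apply: (subsetP sM); apply/in_star; left.
Qed.

(** For [v] in [X], [star v] is the least maximal biclique containing [v]; in the other colour class
    it is the greatest. *)
Lemma starX v B : (exists u, e v u) -> v \in X -> B \in mb -> v \in B -> star v <=b B.
Proof.
move=> nbr vX mB vB; apply: bprecIY => //; first exact: star_mb.
by move=> y yX yB; apply/in_star; left; apply: mb_edge mB _ _ _ _.
Qed.

Lemma starY v B : (exists u, e v u) -> v \notin X -> B \in mb -> v \in B -> B <=b star v.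
Proof.
move=> nbr vX mB vB; apply: bprecI => //.
by move=> y yX yB; apply/in_star; left; rewrite e_sym; apply: mb_edge mB _ _ _ _.
Qed.

(** * Bridges of [H] yield separations of the graph *)

Hypothesis nbr : forall v, exists u, e v u.

(* Deleting the cover [(C, D)] of H corresponds to deleting from the graph all
   the edges between the [X]-shore of [C] and the [Y]-shore of [D]. *)
Definition del_block (C D : {set T}) : rel T :=
  [rel u v | [&& e u v, ~~ [&& u \in C, u \in X, v \in D & v \notin X] &
                        ~~ [&& v \in C, v \in X, u \in D & u \notin X]]].

Lemma del_block_sym C D : symmetric (del_block C D).
Proof. by move=> u v; rewrite /del_block /= e_sym [X in _ && X]andbC. Qed.

(** A chain of covers from [A] to [B] can use the cover [C], [D] only if both lie in the
    interval. *)
Lemma del_edge_H_chain (C D A B : {set T}) : cover C D -> A \in mb -> B \in mb -> A <=b B ->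
  ~~ ((A <=b C) && (D <=b B)) -> connect (del_edge H C D) A B.
Proof.
move=> CD mA mB AB nAB.
apply: (chain_ind (P := fun E F => connect (del_edge H C D) E F)) mA mB AB => //.
  by move=> E F G; exact: connect_trans.
move=> E F EF AE FB; apply: connect1; rewrite /del_edge /= /Hrel EF /=.
apply/andP; split; apply/eqP => -[eqE eqF].
  by case/negP: nAB; rewrite -eqE -eqF AE.
by case/negP: (cover_nbprec CD); rewrite -eqE -eqF; exact: cover_bprec.
Qed.

(** For an edge [x y] with [x] in [X], [star x <=b star y]. If [C] and [D] both lay between these,
    then [x] would be in [C] and [y] in [D], so the edge would be deleted. *)
Lemma del_block_H u v C D : cover C D -> del_block C D u v ->
  connect (del_edge H C D) (star u) (star v).
Proof.
move=> CD; have [mC mD] := cover_mb CD.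
have dirX x y : x \in X -> del_block C D x y -> connect (del_edge H C D) (star x) (star y).
  move=> xX /and3P[xy n1 _]; have yX : y \notin X by rewrite (bipX xy) xX.
  apply: del_edge_H_chain => //; try exact: star_mb.
    by apply: starX => //; [exact: star_mb | apply/in_star; left; rewrite e_sym].
  apply: contra n1 => /andP[xC Dy]; rewrite xX yX !andbT /=; apply/andP; split.
    by apply: (bprecX xC) => //; exact: star_refl.
  by apply: (bprecY mD (star_mb (nbr y)) Dy) => //; exact: star_refl.
have [uX|uX] := boolP (u \in X); first exact: dirX.
move=> uv; have vX : v \in X by case/and3P: uv => /bipX ->.
by rewrite (sym_connect_sym (del_edge_sym H_sym C D)) dirX // del_block_sym.
Qed.

(** A surviving path from [x] to [y] would give a walk of stars from [star x], below [C], to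
    [star y], above [D], joining [C] to [D] without their edge. *)
Lemma bridge_separates C D x y : cover C D -> ~~ connect (del_edge H C D) C D ->
  x \in C -> x \in X -> y \in D -> y \notin X -> ~~ connect (del_block C D) x y.
Proof.
move=> CD bridge xC xX yD yX; apply: contra bridge => xy.
have [mC mD] := cover_mb CD; have csym := sym_connect_sym (del_edge_sym H_sym C D).
have Cx : connect (del_edge H C D) C (star x).
  rewrite csym; apply: del_edge_H_chain => //; try exact: star_mb.
    exact: starX.
  by rewrite negb_and (cover_nbprec CD) orbT.
have Dy : connect (del_edge H C D) (star y) D.
  rewrite csym; apply: del_edge_H_chain => //; try exact: star_mb.
    exact: starY.
  by rewrite negb_and (cover_nbprec CD).
apply: connect_trans Cx (connect_trans _ Dy).
case/connectP: xy => s hs ->; elim: s x {xC xX} hs => //= z s IH x /andP[xz zs].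
exact: connect_trans (del_block_H CD xz) (IH _ zs).
Qed.

Lemma bridges_no_roofed_ipath :
  (forall C D, cover C D -> ~~ connect (del_edge H C D) C D) -> no_roofed_ipath e.
Proof.
move=> bridge p k w ip k2 w0; apply/negP => wk; have [wp ipp] := ip.
have N1k : ~~ e (p 1) (p k).
  by apply/negP => h; have [] := ipp 1 k; [lia | by [] | move=> _ /(_ h); lia].
have N0 i : i <= k -> e (p 0) (p i) -> i = 1.
  case: i => [_ h|i ik h]; first by have := bipX h; case: (p 0 \in X).
  by have [] := ipp 0 i.+1 isT ik; move=> _ /(_ h).
have p01 : e (p 0) (p 1) by apply: wp; lia.
have [p0X|p0X] := boolP (p 0 \in X).
- have wX : w \notin X by rewrite -(bipX w0).
  have pkX : p k \in X by rewrite (bipX wk).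
  have p1X : p 1 \notin X by rewrite (bipX p01) p0X.
  have [A mA sA] : exists2 A, A \in mb & [set p 0; p k; w] \subset A.
    apply: mb_extend; apply: (@bicliqueI _ (p 0) w); rewrite ?inE ?eqxx ?orbT //.
    move=> x y; rewrite !inE -!orbA => /or3P[] /eqP-> xX /or3P[] /eqP-> yX;
      by rewrite ?(negbTE wX) ?p0X ?pkX // in xX yX *; rewrite e_sym.
  have [p0A pkA wA] : [/\ p 0 \in A, p k \in A & w \in A].
    by split; apply: (subsetP sA); rewrite !inE eqxx ?orbT.
  have leA : star (p 0) <=b A by apply: starX.
  have p1A : p 1 \notin A.
    by apply: contra N1k => p1A; rewrite e_sym; apply: mb_edge mA _ _ _ _.
  have p1s : p 1 \in star (p 0) by apply/in_star; left.
  have [C [D [CD sC DA p1C p1D]]] := cover_leaveY (star_mb (nbr _)) mA leA p1s p1A.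
  have [mC mD] := cover_mb CD.
  have p0C : p 0 \in C by apply: (bprecX sC) => //; exact: star_refl.
  have p0D : p 0 \in D by apply: (bprecX (cover_bprec CD)).
  have wD : w \in D by apply: (bprecY mD mA DA).
  apply/negP: (bridge_separates CD (bridge _ _ CD) p0C p0X wD wX); apply/negPn.
  (* A vertex of the path in the [Y]-shore of [D] is adjacent to [p 0], hence is [p 1], which has
     left [D]. So no path edge is deleted. *)
  have pD i : i <= k -> p i \notin X -> p i \notin D.
    move=> ik iX; apply: contra p1D => piD.
    by rewrite -(N0 i ik) //; apply: mb_edge mD _ _ _ _.
  apply: (connect_trans (y := p k)).
    apply: (@walk_connect _ _ p k) => // i ik; rewrite /del_block /= wp //=.
    apply/andP; split; apply/negP => /and4P[_ _ h1 h2].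
      by move: h1; apply/negP/pD.
    by move: h1; apply/negP/pD => //; exact: ltnW.
  (* The edge from [p k] to [w] survives too: [C] contains [p 1], hence not its non-neighbour
     [p k]. *)
  apply: connect1; rewrite /del_block /= e_sym wk wX /= pkX andbF andbT.
  rewrite (negbTE wX) !andbF !andbT; apply/negP => /andP[pkC _].
  by case/negP: N1k; rewrite e_sym; apply: mb_edge mC _ _ _ _.
(* Dual case: [p 1] now enters an [X]-shore, and the forbidden walk runs from [w] to [p k] and back
   along the path to [p 0]. *)
- have wX : w \in X by rewrite -[_ \in _]negbK -(bipX w0).
  have pkX : p k \notin X by rewrite (bipX wk) wX.
  have p1X : p 1 \in X by rewrite (bipX p01).
  have [A mA sA] : exists2 A, A \in mb & [set p 0; p k; w] \subset A.
    apply: mb_extend; apply: (@bicliqueI _ w (p 0)); rewrite ?inE ?eqxx ?orbT //.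
    move=> x y; rewrite !inE -!orbA => /or3P[] /eqP-> xX /or3P[] /eqP-> yX //;
      by rewrite ?wX ?(negbTE p0X) ?(negbTE pkX) // in xX yX *.
  have [p0A pkA wA] : [/\ p 0 \in A, p k \in A & w \in A].
    by split; apply: (subsetP sA); rewrite !inE eqxx ?orbT.
  have leA : A <=b star (p 0) by apply: starY.
  have p1A : p 1 \notin A.
    by apply: contra N1k => p1A; apply: mb_edge mA _ _ _ _.
  have p1s : p 1 \in star (p 0) by apply/in_star; left.
  have [C [D [CD leAC Ds p1C p1D]]] := cover_enterX mA (star_mb (nbr _)) leA p1A p1s.
  have [mC mD] := cover_mb CD.
  have p0D : p 0 \in D by apply: (bprecY mD _ Ds) => //; [exact: star_mb | exact: star_refl].
  have p0C : p 0 \in C by apply: (bprecY mC mD (cover_bprec CD)).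
  have wC : w \in C by apply: (bprecX leAC).
  apply/negP: (bridge_separates CD (bridge _ _ CD) wC wX p0D p0X); apply/negPn.
  have pC i : i <= k -> p i \in X -> p i \notin C.
    move=> ik iX; apply: contra p1C => piC.
    by rewrite -(N0 i ik) // e_sym; apply: mb_edge mC _ _ _ _.
  apply: (connect_trans (y := p k)); last first.
    rewrite (sym_connect_sym (del_block_sym C D)).
    apply: (@walk_connect _ _ p k) => // i ik; rewrite /del_block /= wp //=.
    apply/andP; split; apply/negP => /and4P[h1 h2 _ _].
      by move: h1; apply/negP/pC => //; exact: ltnW.
    by move: h1; apply/negP/pC.
  apply: connect1; rewrite /del_block /= wk wX /= (negbTE pkX) !andbF !andbT.
  apply/negP => /andP[_ pkD].
  by case/negP: N1k; apply: mb_edge mD _ _ _ _.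
Qed.

(** * Without roofed induced paths, every cover is a bridge of [H] *)

Lemma nocomp_mb (A B : {set T}) : A \in mb -> B \in mb -> ~~ (A <=b B) ->
  exists a b, [/\ a \in A, a \in X, b \in B, b \notin X & ~~ e a b].
Proof.
move=> mA mB nAB; have [a aAX aBX] := subsetPn nAB.
move: aAX aBX; rewrite !inE => /andP[aA aX]; rewrite aX andbT => aB.
have [/exists_inP[b bB /andP[bX ab]]|none] :=
    boolP [exists b in B, (b \notin X) && ~~ e a b]; first by exists a, b.
case/negP: aB; apply: mb_memX => // y yB yX.
by have := exists_inPn none y yB; rewrite yX negbK.
Qed.

(* Two incomparable maximal bicliques meeting in both shores span a domino. *)
Lemma mb_comparable (A B : {set T}) x y : no_roofed_ipath e ->
  A \in mb -> B \in mb -> x \in A -> x \in B -> x \in X ->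
  y \in A -> y \in B -> y \notin X -> (A <=b B) || (B <=b A).
Proof.
move=> roof mA mB xA xB xX yA yB yX; rewrite -[_ || _]negbK negb_or; apply/negP.
case/andP=> /(nocomp_mb mA mB)[a [b [aA aX bB bX nab]]].
case/(nocomp_mb mB mA)=> c [d [cB cX dA dX ncd]].
have eA := fun u v uA uX vA vX => @mb_edge A u v mA uA uX vA vX.
have eB := fun u v uB uX vB vX => @mb_edge B u v mB uB uX vB vX.
have same u v : (u \in X) = (v \in X) -> e u v = false.
  by move=> uv; apply/negP => /bipX; rewrite uv; case: (v \in X).
have [ad xd xb cb] : [/\ e a d, e x d, e x b & e c b] by split; auto.
(* This induced path of length 4 is roofed by [y]. *)
pose s := [:: a; d; x; b; c].
have ip : ipath e (nth a s) 4.
  have nX u v : u \in X -> v \notin X -> u <> v /\ v <> u.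
    by move=> uX vX; split=> uv; move: vX; rewrite ?uv ?uX // -uv uX.
  split.
    by case=> [|[|[|[|i]]]] // _; rewrite /= ?(e_sym d) ?(e_sym b).
  have nad := nX _ _ aX dX; have nab' := nX _ _ aX bX.
  have nxd := nX _ _ xX dX; have nxb := nX _ _ xX bX.
  have ncd' := nX _ _ cX dX; have ncb := nX _ _ cX bX.
  have nax : a <> x by move=> ax; rewrite ax xb in nab.
  have nac : a <> c by move=> ac; rewrite ac cb in nab.
  have nxc : x <> c by move=> xc; rewrite -xc xd in ncd.
  have ndb : d <> b by move=> db; rewrite db cb in ncd.
  have sX u v : u \in X -> v \in X -> e u v = false.
    by move=> uX vX; rewrite same ?uX ?vX.
  have sY : e d b = false by rewrite same ?(negbTE dX) ?(negbTE bX).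
  have edc : e d c = false by rewrite e_sym (negbTE ncd).
  have eab : e a b = false by rewrite (negbTE nab).
  case=> [|[|[|[|[|i]]]]] [|[|[|[|[|j]]]]] //= _ _; split=> //;
    by first [tauto | by rewrite ?sY ?edc ?eab | rewrite sX].
have ya : e y a by rewrite e_sym; auto.
have yc : e y c by rewrite e_sym; auto.
by case/negP: (roof _ 4 y ip isT ya).
Qed.

Lemma no_roofed_ipath_separates C D : no_roofed_ipath e -> cover C D ->
  forall n p, walk (del_block C D) p n -> p 0 \in C -> p 0 \in X ->
  p n \in D -> p n \notin X -> False.
Proof.
move=> roof CD; have [mC mD] := cover_mb CD; have leCD := cover_bprec CD.
have de u v : del_block C D u v -> e u v by case/and3P.
elim/ltn_ind=> n IH p wp p0C p0X pnD pnX.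
have [_ ip] : ipath (del_block C D) p n.
  apply: shortest_walk_ipath wp _ => m q mn wq q0 qm.
  by apply: (IH m mn q wq); rewrite ?q0 ?qm.
(* By minimality only the first vertex is in the [X]-shore of [C]; likewise below, only the last is
   in the [Y]-shore of [D]. *)
have notC i : 0 < i -> i <= n -> p i \in X -> p i \notin C.
  move=> i0 i_n iX; apply/negP => iC.
  apply: (IH (n - i) _ (fun t => p (i + t))); rewrite ?addn0 ?subnKC //.
    by rewrite ltn_subrL i0 (leq_trans i0).
  by move=> t ti; rewrite addnS; apply: wp; rewrite -ltn_subRL.
have notD i : i < n -> p i \notin X -> p i \notin D.
  move=> i_n iX; apply/negP => iD; apply: (IH i i_n p) => // t ti.
  by apply: wp; exact: ltn_trans i_n.
have p0D : p 0 \in D by apply: (bprecX leCD).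
have p0n : e (p 0) (p n) by apply: mb_edge mD _ _ _ _.
have wpe i : i < n -> e (p i) (p i.+1) by move/wp/de.
case: n => [|[|[|[|n]]]] in IH wp pnD pnX ip notC notD p0n wpe *.
- by rewrite p0X in pnX.
- by case/and3P: (wp 0 isT) => _ n1 _; case/negP: n1; apply/and4P.
- by move: pnX; rewrite (bipX (wpe 1 isT)) (bipX (wpe 0 isT)) p0X.
(* Length 3: [M] meets both [C] and [D] in [p 0] and [p 3], so it is comparable to each. As [p 2] is
   outside [C] and [p 1] outside [D], it lies strictly between them. *)
- have p1X : p 1 \notin X by rewrite (bipX (wpe 0 isT)) p0X.
  have p2X : p 2 \in X by rewrite (bipX (wpe 1 isT)).
  have [M mM sM] : exists2 M, M \in mb & [set p 0; p 1; p 2; p 3] \subset M.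
    apply: mb_extend; apply: (@bicliqueI _ (p 0) (p 3)); rewrite ?inE ?eqxx ?orbT //.
    have [e01 e12 e23] := And3 (wpe 0 isT) (wpe 1 isT) (wpe 2 isT).
    move=> x y; rewrite !inE -!orbA => /or4P[] /eqP-> xX /or4P[] /eqP-> yX //;
      by rewrite ?p0X ?p2X ?(negbTE p1X) ?(negbTE pnX) // e_sym in xX yX *.
  have [p0M p1M p2M p3M] : [/\ p 0 \in M, p 1 \in M, p 2 \in M & p 3 \in M].
    by split; apply: (subsetP sM); rewrite !inE eqxx ?orbT.
  have p3C : p 3 \in C by apply: (bprecY mC mD).
  have leCM : C <=b M.
    case/orP: (mb_comparable roof mC mM p0C p0M p0X p3C p3M pnX) => // MC.
    by case/negP: (notC 2 isT isT p2X); apply: (bprecX MC).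
  have leMD : M <=b D.
    case/orP: (mb_comparable roof mM mD p0M p0D p0X p3M pnD pnX) => // DM.
    by case/negP: (notD 1 isT p1X); apply: (bprecY mD mM DM).
  case/coverP: CD => _ _ _ _ /(_ M mM leCM leMD) [eqM|eqM].
    by case/negP: (notC 2 isT isT p2X); rewrite -eqM.
  by case/negP: (notD 1 isT p1X); rewrite -eqM.
(* Without [p 0] the path avoids the [X]-shore of [C], so a deleted edge cannot be a chord of it;
   [p 0] is its roof. *)
- have ipe : ipath e (fun t => p (1 + t)) n.+3.
    split=> [i i_n|i j ij jn]; first by rewrite addnS; apply: wpe.
    have [//|//|np h] := ip (1 + i) (1 + j).
    split=> // eij; apply/eqP; rewrite -eqSS; apply/eqP; apply: h.
    rewrite /del_block /= eij /=; apply/andP; split; apply/negP => /and4P[].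
      by move=> iC iX _ _; case/negP: (notC (1 + i) isT (leqW (leq_trans ij jn)) iX).
    by move=> _ _ iD iX; case/negP: (notD (1 + i) (leq_trans ij jn) iX).
  by case/negP: (roof _ _ (p 0) ipe isT (wpe 0 isT)).
Qed.

Lemma no_roofed_ipath_bridge C D : no_roofed_ipath e -> cover C D ->
  ~~ connect (del_edge H C D) C D.
Proof.
move=> roof CD; have [mC mD] := cover_mb CD.
(* [Q] is the side of [C] in the separated graph. Having its [X]-shore inside [Q] will be invariant
   along the remaining edges of [H], true of [C] and false of [D]. *)
pose Q := [set v | [exists x in C, (x \in X) && connect (del_block C D) x v]].
have CQ x : x \in C -> x \in X -> x \in Q.
  by move=> xC xX; rewrite inE; apply/exists_inP; exists x; rewrite // xX connect0.
have QD y : y \in D -> y \notin X -> y \notin Q.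
  move=> yD yX; rewrite inE; apply/negP => /exists_inP[x xC /andP[xX]].
  case/connect_walk=> p [n [wp p0 pn]].
  by apply: (no_roofed_ipath_separates roof CD wp); rewrite ?p0 ?pn.
have Qdel u v : del_block C D u v -> (u \in Q) = (v \in Q).
  move=> uv; rewrite !inE; apply: eq_existsb => x; congr [&& _, _ & _].
  by apply: (same_connect_r (sym_connect_sym (del_block_sym C D))); exact: connect1.
pose I (B : {set T}) := [forall x in B, (x \in X) ==> (x \in Q)].
have IP (B : {set T}) : reflect (forall x, x \in B -> x \in X -> x \in Q) (I B).
  apply: (iffP forall_inP) => h x xB; first by move=> xX; have := h x xB; rewrite xX.
  by apply/implyP; exact: h.
have IC : I C by apply/IP.
have nID : ~~ I D.
  apply/negP => /IP hD; have [y yD yX] := mb_hasY mD.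
  have /subsetPn[z] := cover_nbprec CD; rewrite !inE => /andP[zD zX].
  rewrite zX andbT => zC; case/negP: (QD y yD yX).
  rewrite -(Qdel z y) ?hD // /del_block /= (mb_edge mD) //= (negbTE zC) /=.
  by rewrite (negbTE yX) /= andbF.
(* If [X(A) \subset Q] but [z \in X(B)] is outside [Q], then [Y(B)], being adjacent
   to [z], avoids [Q], so all edges between [X(A)] and [Y(B)] are deleted ones. *)
have step A B : cover A B -> (A, B) != (C, D) -> I A = I B.
  move=> AB neq; have [mA mB] := cover_mb AB; have leAB := cover_bprec AB.
  apply/idP/idP => /IP h; last by apply/IP => x xA xX; apply: h; rewrite ?(bprecX leAB).
  apply/IP => z zB zX; apply/negPn/negP => zQ.
  have zC : z \notin C by apply: contra zQ => zC; exact: CQ.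
  have BQ y : y \in B -> y \notin X -> y \notin Q.
    move=> yB yX; rewrite -(Qdel z y) // /del_block /= (mb_edge mB) //= (negbTE zC) /=.
    by rewrite (negbTE yX) /= andbF.
  have block x y : x \in A -> x \in X -> y \in B -> y \notin X -> x \in C /\ y \in D.
    move=> xA xX yB yX; apply/andP/negPn/negP => nblock.
    have : (x \in Q) = (y \in Q).
      apply: Qdel; rewrite /del_block /= (mb_edge mA) //; last exact: bprecY mA mB leAB yX yB.
      by rewrite xX (negbTE yX) /= ?andbF ?andbT.
    by rewrite h // (negbTE (BQ y yB yX)).
  have leAC : A <=b C.
    have [y yB yX] := mb_hasY mB.
    by apply: bprecI => x xX xA; case: (block x y).
  have leDB : D <=b B.
    have [x xA xX] := mb_hasX mA.
    by apply: bprecIY => // y yX yB; case: (block x y).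
  (* Now [C] and [D] lie between [A] and [B]; a cover leaves room for this only when the two pairs
     coincide. *)
  case/coverP: AB neq => _ _ nAB _ hAB; have leCD := cover_bprec CD.
  have nDA : D <> A.
    by move=> DA; case/negP: (cover_nbprec CD); rewrite DA.
  have nCB : C <> B.
    by move=> CB; case/negP: (cover_nbprec CD); rewrite CB.
  have [->|//] := hAB C mC leAC (bprec_trans leCD leDB).
  by have [//|->] := hAB D mD (bprec_trans leAC leCD) leDB; rewrite eqxx.
have stepH A B : del_edge H C D A B -> I A = I B.
  case/and3P=> /orP[] AB nCD nDC; first exact: step.
  by apply/esym/step => //; apply: contra nDC; rewrite !xpair_eqE andbC.
have Ilast s E : path (del_edge H C D) E s -> I (last E s) = I E.
  by elim: s E => //= F s IH E /andP[/stepH -> /IH].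
by apply: contra nID => /connectP[s hs ->]; rewrite Ilast.
Qed.

(** Adjacent vertices have comparable stars, and each maximal biclique lies above the star of a
    vertex of its [X]-shore, so walks of the graph transfer to [H]. *)
Lemma mb_connect A B : (forall u v, connect e u v) ->
  A \in mb -> B \in mb -> connect H A B.
Proof.
move=> conn mA mB; have Hs := sym_connect_sym H_sym.
have le_conn E F : E \in mb -> F \in mb -> E <=b F -> connect H E F.
  move=> mE mF EF; apply: (chain_ind (P := connect H)) mE mF EF => //.
    by move=> D C G; exact: connect_trans.
  by move=> C D CD _ _; apply: connect1; rewrite /Hrel CD.
have star_conn u v : e u v -> connect H (star u) (star v).
  have dirX x y : x \in X -> e x y -> connect H (star x) (star y).
    move=> xX xy; apply: le_conn; try exact: star_mb.
    by apply: starX => //; [exact: star_mb | apply/in_star; left; rewrite e_sym].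
  move=> uv; have [uX|uX] := boolP (u \in X); first exact: dirX.
  by rewrite Hs dirX // ?(bipX uv) // e_sym.
have to_star E : E \in mb -> exists v, connect H E (star v).
  move=> mE; have [x xE xX] := mb_hasX mE; exists x; rewrite Hs.
  by apply: le_conn => //; [exact: star_mb | exact: starX].
have [u Au] := to_star A mA; have [v Bv] := to_star B mB.
apply: connect_trans Au (connect_trans _ _); last by rewrite Hs; exact: Bv.
case/connectP: (conn u v) => s hs ->.
elim: s u hs => //= z s IH u /andP[uz zs].
exact: connect_trans (star_conn _ _ uz) (IH _ zs).
Qed.

End Bicliques.

Theorem theorem1 (T : finType) (e : rel T) (X : {set T}) :
  symmetric e -> irreflexive e ->
  bipartite_with e X ->
  connected_on e [set: T] ->
  (forall v : T, ~~ universal e X v) ->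
  (tree_on (Hrel e X) (maxbicliques e X) <-> BDH e X).
Proof.
move=> e_sym e_irr bip [/set0Pn[v0 _] connT] nuniv.
have conn u v : connect e u v.
  by have [_ [s [hs <- _]]] := connT u v (in_setT _) (in_setT _); apply/connectP; exists s.
(* A non-universal [v] has a vertex [w] in the opposite class, so a path from [v] to [w] has a first
   edge. *)
have nbr v : exists u, e v u.
  have /forallPn[w] := nuniv v; rewrite negb_imply => /andP[vw _].
  case/connectP: (conn v w) => -[|u s] /=; first by move=> _ eq_vw; rewrite eq_vw eqxx in vw.
  by case/andP=> vu _ _; exists u.
split=> [[_ acyc]|[_ dh]].
- split=> //; apply: no_roofed_ipath_DH => //.
  apply: (bridges_no_roofed_ipath e_sym bip nbr) => C D CD.
  have CDH : Hrel e X C D by rewrite /Hrel CD.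
  apply: (acyclic_bridge (@H_sym _ e X) _ acyc CDH (H_neq CDH)).
  by move=> A B; exact: H_mb.
- have roof := DH_no_roofed_ipath e_sym dh.
  split; last first.
    move=> c _; apply: bridges_acyclic; first exact: H_sym.
    move=> A B /orP[] AB; first exact: no_roofed_ipath_bridge.
    rewrite (sym_connect_sym (del_edge_sym (@H_sym _ e X) A B)).
    rewrite (eq_connect (del_edgeC (Hrel e X) A B)).
    exact: no_roofed_ipath_bridge.
  split; first by apply/set0Pn; exists (star e v0); exact: star_mb.
  move=> A B mA mB; apply: connect_conn_in => //.
  rewrite (_ : connect _ A B = connect (Hrel e X) A B); first exact: mb_connect.
  apply: eq_connect => E F /=; case EF: (Hrel e X E F) => //=.
  by rewrite (H_mb EF) (H_mb (_ : Hrel e X F E)) // H_sym.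
Qed.
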